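(* Let $M$ be a sclocc median algebra and let $\mu$ be a balanced Borel probability measure on $M$. Then the support of $\mu$ is a cube in $M$.
   Context: A median algebra is a set $M$ with a ternary operation $m:M^3\to M$ (the median operator) such that for all $x,y,z,u,v\in M$: (1) $m(x,y,z)=m(x,z,y)=m(y,x,z)$; (2) $m(x,x,y)=x$; (3) $m(m(x,y,z),u,v)=m(x,m(y,u,v),m(z,u,v))$. A median morphism is a map $\varphi$ between median algebras with $\varphi(m(x,y,z))=m(\varphi(x),\varphi(y),\varphi(z))$. For $x,y\in M$ the interval is $[x,y]=\{u\in M: m(x,y,u)=u\}$; a subset $C\subset M$ is convex if $[x,y]\subset C$ for all $x,y\in C$. A topological median algebra is a median algebra with a Hausdorff topology for which $m$ is continuous. It is locally open-convex if every point has a basis of open and convex neighborhoods. It is sclocc if it is second countable, locally open-convex and compact. For a sclocc median algebra $M$, $\operatorname{Prob}(M)$ is the set of Borel probability measures on $M$, and the self-median operator is $\Phi:\operatorname{Prob}(M)\to\operatorname{Prob}(M)$, $\Phi(\mu)=m_*(\mu^3)$, where $\mu^3=\mu\otimes\mu\otimes\mu$. A measure $\mu$ is balanced if $\Phi(\mu)=\mu$. The support of $\mu$ is the minimal closed set with null complement. The set $\{0,1\}$ carries the standard (majority) median operation; $\{0,1\}^I$ carries the coordinate-wise median and the product topology. A cube in $M$ is a subset of the form $f(\{0,1\}^I)$ where $I$ is a countable (possibly finite or empty) set and $f:\{0,1\}^I\to M$ is an injective continuous median morphism. *)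

(* Defs.v *)
From HB Require Import structures.
From mathcomp Require Import all_boot all_order all_algebra.
From mathcomp Require Import all_classical all_reals all_analysis.

Set Implicit Arguments.
Unset Strict Implicit.
Unset Printing Implicit Defensive.

Local Open Scope classical_set_scope.
Local Open Scope ereal_scope.

Record median_algebra (T : Type) (m : T -> T -> T -> T) : Prop := MedianAlgebra {
  median_swap23 : forall x y z, m x y z = m x z y ;
  median_swap12 : forall x y z, m x y z = m y x z ;
  median_xx : forall x y, m x x y = x ;
  median_distr : forall x y z u v,
    m (m x y z) u v = m x (m y u v) (m z u v) }.

Definition median_morphism (T U : Type) (m : T -> T -> T -> T)
    (n : U -> U -> U -> U) (f : T -> U) : Prop :=
  forall x y z, f (m x y z) = n (f x) (f y) (f z).

Definition median_interval (T : Type) (m : T -> T -> T -> T) (x y : T) : set T :=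
  [set u | m x y u = u].

Definition median_convex (T : Type) (m : T -> T -> T -> T) (C : set T) : Prop :=
  forall x y, C x -> C y -> median_interval m x y `<=` C.

Definition uncurry3 (T U : Type) (m : T -> T -> T -> U) (p : T * T * T) : U :=
  m p.1.1 p.1.2 p.2.

Record topological_median_algebra (T : topologicalType)
    (m : T -> T -> T -> T) : Prop := TopologicalMedianAlgebra {
  topological_median : median_algebra m ;
  topological_median_hausdorff : hausdorff_space T ;
  topological_median_continuous : continuous (uncurry3 m) }.

Definition locally_open_convex (T : topologicalType) (m : T -> T -> T -> T) : Prop :=
  forall (x : T) (U : set T), nbhs x U ->
    exists V : set T, [/\ open V, median_convex m V, V x & V `<=` U].

Record sclocc (T : topologicalType) (m : T -> T -> T -> T) : Prop := Sclocc {
  sclocc_topological : topological_median_algebra m ;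
  sclocc_second_countable : @second_countable T ;
  sclocc_locally_open_convex : locally_open_convex m ;
  sclocc_compact : compact [set: T] }.

(* T is pointed because the library's measurable types are; this loses nothing,
   as a space carrying a probability measure is nonempty. *)
Notation borel T := (g_sigma_algebraType (@open T)).

(* (mu \x mu) \x mu lives on the product sigma-algebra of three copies of borel T;
   m is measurable for it by measurable_median below. *)
Definition self_median (R : realType) (T : ptopologicalType)
    (m : T -> T -> T -> T) (mu : probability (borel T) R) : set (borel T) -> \bar R :=
  pushforward ((mu \x mu) \x mu) (uncurry3 m : borel T * borel T * borel T -> borel T).

Definition balanced (R : realType) (T : ptopologicalType)
    (m : T -> T -> T -> T) (mu : probability (borel T) R) : Prop :=
  forall A : set (borel T), measurable A -> self_median m mu A = mu A.

Definition measure_support (R : realType) (T : ptopologicalType)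
    (mu : probability (borel T) R) : set T :=
  \bigcap_(C in [set C : set T | closed C /\ mu (~` C) = 0]) C.

Lemma borel_open (T : ptopologicalType) (U : set T) :
  open U -> measurable (U : set (borel T)).
Proof. by move=> oU; exact: sub_sigma_algebra. Qed.

Lemma measurable_median (T : ptopologicalType) (m : T -> T -> T -> T) :
    @second_countable T -> continuous (uncurry3 m) ->
  measurable_fun [set: borel T * borel T * borel T]
    (uncurry3 m : borel T * borel T * borel T -> borel T).
Proof.
move=> [B cB [oB nbB]] cm.
apply: (@measurability _ _ _ (borel T) _ _ (@open T)) => // _ [U oU <-].
rewrite setTI; set W := _ @^-1` U.
pose box (X : set T * set T * set T) : set (borel T * borel T * borel T) :=
  X.1.1 `*` X.1.2 `*` X.2.
pose N := [set X | (B `*` B `*` B) X /\ box X `<=` W].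
have -> : W = \bigcup_(X in N) box X.
  apply/seteqP; split=> [[[x y] z] Wxyz|p [X [_ XW] /XW//]].
  have : nbhs ((x, y, z) : T * T * T) W.
    by apply: (cm (x, y, z)); apply: open_nbhs_nbhs; split.
  move=> [[P Q] /= [[[P1 P2] /= [xP1 yP2] P12] zQ] PQ].
  have [V1 [BV1 V1x] V1P] := nbB _ _ xP1.
  have [V2 [BV2 V2y] V2P] := nbB _ _ yP2.
  have [V3 [BV3 V3z] V3Q] := nbB _ _ zQ.
  exists (V1, V2, V3) => //; split=> // -[[a b] c] /= [[/= Va Vb] Vc].
  apply: (PQ (a, b, c)); split; last exact: V3Q.
  by apply: (P12 (a, b)); split; [exact: V1P|exact: V2P].
have cN : countable N.
  have cB3 : countable (B `*` B `*` B) by do !apply: countableX.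
  by apply: sub_countable cB3; apply: subset_card_le => X [].
have /pfcard_geP[->|[e]] := cN; first by rewrite bigcup_set0.
rewrite -(image_eq e) bigcup_image; apply: bigcupT_measurable => n.
have : N (e n) by exact: funS.
case: (e n) => [[X Y] Z] [[[/= BX BY] BZ] _].
by apply: measurableX; [apply: measurableX|]; apply: borel_open; exact: oB.
Qed.

Lemma closed_measure_support (R : realType) (T : ptopologicalType)
  (mu : probability (borel T) R) : closed (measure_support mu).
Proof. by apply: closed_bigI => C []. Qed.

Lemma measure_support_min (R : realType) (T : ptopologicalType)
    (mu : probability (borel T) R) (C : set T) :
  closed C -> mu (~` C) = 0 -> measure_support mu `<=` C.
Proof. by move=> cC muC x; apply. Qed.

Lemma measure_support_conull (R : realType) (T : ptopologicalType)
    (mu : probability (borel T) R) :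
  @second_countable T -> mu (~` measure_support mu) = 0.
Proof.
move=> [B cB [oB nbB]].
pose N := [set V : set (borel T) | B V /\ mu V = 0].
have supE : ~` measure_support mu = \bigcup_(V in N) V.
  rewrite /measure_support setC_bigcap; apply/seteqP.
  split=> [x [C [cC muC] Cx]|x [V [BV muV] Vx]].
    have /nbB [V [BV Vx] VC] : nbhs x (~` C).
      by apply: open_nbhs_nbhs; split => //; exact: closed_openC.
    exists V => //; split => //.
    apply: (subset_measure0 (mu := mu) _ _ VC muC).
      exact: (borel_open (oB _ BV)).
    exact: (borel_open (closed_openC cC)).
  by exists (~` V); rewrite /= ?setCK//; split => //; exact/open_closedC/oB.
have cN : countable N by apply: sub_countable cB; apply: subset_card_le => V [].
have mS : measurable (~` measure_support mu : set (borel T)).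
  exact: (borel_open (closed_openC (@closed_measure_support R T mu))).
apply/(negligibleP mu mS); rewrite supE; have /pfcard_geP[->|[e]] := cN.
  by rewrite bigcup_set0; exact: negligible_set0.
rewrite -(image_eq e) bigcup_image.
apply: negligible_bigcup => n; have [BV muV] : N (e n) by exact: funS.
exact/(negligibleP mu (borel_open (oB _ BV))).
Qed.

Definition majority (a b c : bool) : bool := [|| a && b, b && c | c && a].

Definition cube_median (I : Type) (x y z : {ptws I -> bool}) : {ptws I -> bool} :=
  fun i => majority (x i) (y i) (z i).

Definition is_cube (T : topologicalType) (m : T -> T -> T -> T) (S : set T) : Prop :=
  exists (I : Type) (f : {ptws I -> bool} -> T),
    [/\ countable [set: I], injective f, continuous f,
        median_morphism (@cube_median I) m f & S = range f].

(* Main.v *)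
Require Import Defs.
From mathcomp Require Import all_boot all_order all_algebra finmap.
From mathcomp Require Import all_classical all_reals all_analysis.
From mathcomp Require Import ring lra.

(** Call a set a halfspace when its indicator is a median morphism to
[{0, 1}], that is, when it and its complement are convex.  If [H] is a Borel
halfspace, balancedness of [mu] reads [p = p^3 + 3 p^2 (1 - p)] for
[p = mu H], so [mu H] is [0], [1/2] or [1] ([balanced_halfspace]).  For two
halfspaces of measure [1/2], the pair of indicators pushes [mu] to a balanced
measure on the square, and the same computation says that their intersection
has measure [0], [1/2] or [1/4] ([balanced_halfspace_pair]): up to null sets,
they are complementary, equal, or independent.

There are enough halfspaces.  Given [x <> y], the interval [[x, y]] is a compact
distributive lattice with bottom [x] and top [y], in which disjoint open convex
neighborhoods of [x] and [y] make it possible to choose an element [p <> y]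
which is meet-prime and lies above a neighborhood of [x].  Then the [z] with
[m x y z <= p] form a closed halfspace, a neighborhood of [x] that misses [y]
([closed_halfspace_nbhs]).  Doing the same with [y] and [p] yields disjoint
closed halfspaces which are neighborhoods of [x] and of [y]
([disjoint_closed_halfspaces]).

If [x] and [y] lie in the support [S], neither halfspace is null or conull, so
both have measure [1/2]; their union is closed and conull, hence contains [S].
Thus points of [S] are separated by walls, meaning disjoint pairs of closed
halfspaces that cover [S] ([exists_support_wall]).  Each wall is oriented by a
base point of [S] and identified with its trace on [S]; by the computation
above, distinct walls are independent, so that all four intersections of their
sides meet [S] ([support_wall_cross]).  The Helly property of convex sets and
compactness then realize every choice of sides by a point of [S], a unique one
by separation, and the resulting bijection from [{0, 1}^I] to [S] is a
continuous median morphism ([is_cube_walls]).  Second countability leaves only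
countably many walls. *)

Set Implicit Arguments.
Unset Strict Implicit.
Unset Printing Implicit Defensive.

Import Order.TTheory GRing.Theory Num.Theory.

Local Open Scope classical_set_scope.

(** * Median algebra *)

Section MedianAlgebra.
Context (T : Type) (m : T -> T -> T -> T) (Mm : median_algebra m).

Lemma median_rot x y z : m x y z = m y z x.
Proof. by rewrite (median_swap12 Mm) (median_swap23 Mm). Qed.

Lemma median_xyx x y : m x y x = x.
Proof. by rewrite (median_swap23 Mm) (median_xx Mm). Qed.

Lemma median_yxx x y : m y x x = x.
Proof. by rewrite median_rot (median_xx Mm). Qed.

Lemma median_distr1 a b x y z : m a b (m x y z) = m x (m a b y) (m a b z).
Proof.
by rewrite -(median_rot _ a b) (median_distr Mm) !(median_rot _ a b).
Qed.

Lemma median_idem a b x : m a b (m a b x) = m a b x.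
Proof.
by rewrite -{1}(median_rot x) median_distr1 median_xyx median_yxx median_rot.
Qed.

(** Each [m a b] is the projection onto the interval between [a] and [b], and
this projection is a median morphism. *)
Lemma medianM a b x y z : m a b (m x y z) = m (m a b x) (m a b y) (m a b z).
Proof.
rewrite -median_idem (median_distr1 _ _ x) (median_swap12 Mm x) median_distr1.
by rewrite median_idem (median_swap12 Mm).
Qed.

Lemma median_convexP (C : set T) :
  median_convex m C <-> forall a b c, C a -> C b -> C (m a b c).
Proof.
split=> [cC a b c Ca Cb|cC a b Ca Cb u uab]; last by rewrite -uab; apply: cC.
by have := cC a b Ca Cb; apply; rewrite /median_interval /= median_idem.
Qed.

(** The equation [m x c d = c] says that [c] lies between [x] and [d]; it is
read as [c <= d] in the semilattice order with bottom [x], whose meet is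
[m x]. *)
Lemma median_le_trans x c d e : m x c d = c -> m x d e = d -> m x c e = c.
Proof.
move=> cd de; rewrite -[in LHS]cd (median_swap23 Mm) (median_swap12 Mm x c).
by rewrite median_distr1 median_xyx (median_swap23 Mm x e) de (median_swap12 Mm) cd.
Qed.

Definition halfspace (A : set T) : Prop :=
  median_morphism m majority (fun z => z \in A).

Lemma halfspaceP (A : set T) :
  median_convex m A -> median_convex m (~` A) -> halfspace A.
Proof.
move=> /median_convexP cA /median_convexP cA' a b c.
have inA u v w : u \in A -> v \in A -> m u v w \in A.
  by rewrite !inE; exact: cA.
have ninA u v w : (u \in A) = false -> (v \in A) = false ->
    (m u v w \in A) = false.
  move=> Au Av; apply/negbTE; rewrite -in_setC inE.
  by apply: cA'; apply/set_mem; rewrite in_setC ?Au ?Av.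
case aA : (a \in A); case bA : (b \in A); case eA : (c \in A) => /=.
- exact: inA.
- exact: inA.
- by rewrite (median_swap23 Mm); exact: inA.
- by rewrite median_rot; exact: ninA.
- by rewrite median_rot; exact: inA.
- by rewrite (median_swap23 Mm); exact: ninA.
- exact: ninA.
- exact: ninA.
Qed.

Lemma halfspace_convex (A : set T) : halfspace A -> median_convex m A.
Proof.
move=> hA; apply/median_convexP => a b c Aa Ab; apply/set_mem.
by have := hA a b c; rewrite /= (mem_set Aa) (mem_set Ab).
Qed.

(** In the lattice between [x] and [y], the equation [m x p z = m x y z] says that
the projection [m x y z] of [z] lies below [p].  So the set is the preimage,
under a median morphism, of the principal ideal of [p], and primality of [p]
makes the complement of that ideal convex. *)
Lemma halfspace_prime x y p : m x y p = p ->
  (forall a b, m x y a = a -> m x y b = b ->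
    m x p (m x a b) = m x a b -> m x p a = a \/ m x p b = b) ->
  halfspace [set z | m x p z = m x y z].
Proof.
move=> pxy prime.
have proj z : m x p (m x y z) = m x p z.
  by rewrite medianM (median_xyx x p) (median_swap23 Mm x p y) pxy median_idem.
apply: halfspaceP; apply/median_convexP => a b c /=.
  rewrite -(proj a) -(proj b) -(proj (m a b c)) (medianM x y) => Ha Hb.
  by rewrite -(median_rot _ (m x y a)) median_distr1 Ha Hb.
rewrite -(proj a) -(proj b) -(proj (m a b c)) (medianM x y) => Ha Hb Habc.
set a' := m x y a in Ha Habc; set b' := m x y b in Hb Habc.
set c' := m x y c in Habc.
(* The meet of [a'] and [b'] lies below every point between them. *)
have ab : m x (m x a' b') (m a' b' c') = m x a' b'.
  by rewrite (median_rot x a' b') -median_distr1 (median_xx Mm).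
have abp : m x p (m x a' b') = m x a' b'.
  rewrite (median_swap23 Mm); apply: (median_le_trans ab).
  by rewrite (median_swap23 Mm).
by case: (prime a' b') => //; rewrite /a' /b' median_idem.
Qed.

End MedianAlgebra.

(** * Separating points by closed halfspaces *)

Section TopologicalMedianAlgebra.
Context (T : ptopologicalType) (m : T -> T -> T -> T) (Mm : sclocc m).

Let M : median_algebra m := topological_median (sclocc_topological Mm).

Lemma closed_eq_continuous (f g : T -> T) :
  continuous f -> continuous g -> closed [set z | f z = g z].
Proof.
move=> cf cg p clp.
apply: (topological_median_hausdorff (sclocc_topological Mm)) => U V Uf Vg.
have Up : nbhs p (f @^-1` U) by exact: cf.
have Vp : nbhs p (g @^-1` V) by exact: cg.
have [z [/= fgz [Uz Vz]]] := clp _ (filterI Up Vp).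
by exists (f z); split => //; rewrite fgz.
Qed.

Lemma continuous_median_arg (f g h : T -> T) :
  continuous f -> continuous g -> continuous h ->
  continuous (fun z => m (f z) (g z) (h z)).
Proof.
move=> cf cg ch z.
have cm := topological_median_continuous (sclocc_topological Mm).
have fgh : (fun z => ((f z, g z), h z)) @ z --> ((f z, g z), h z).
  exact: (cvg_pair (cvg_pair (cf z) (cg z)) (ch z)).
exact: (cvg_comp _ _ fgh (cm _)).
Qed.

Let cid : continuous (fun z : T => z). Proof. by move=> z. Qed.
Let ccst (a : T) : continuous (fun _ : T => a).
Proof. by move=> z; exact: cvg_cst. Qed.

(** Zorn's lemma applies because the sets of upper bounds are closed: by
compactness, a chain in [K] has an upper bound in [K]. *)
Lemma compact_maximal x (K : set T) k0 : closed K -> K k0 ->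
  exists k, [/\ K k, m x k0 k = k0 & forall z, K z -> m x k z = k -> z = k].
Proof.
move=> clK Kk0.
pose E := {z : T | K z /\ m x k0 z = k0}.
pose R : rel E := fun s t => `[< m x (sval s) (sval t) = sval s >].
have [|r s t /asboolP rs /asboolP st|s t /asboolP st /asboolP ts|A totA|] :=
    @Zorn E R.
- by move=> t; apply/asboolP; exact: median_yxx.
- exact/asboolP/(median_le_trans M rs).
- by apply: eq_sig_hprop => [? ? ?|]; [exact: Prop_irrelevance|];
    rewrite -st (median_swap23 M).
- pose D := k0 |` (sval @` A).
  pose g c := K `&` [set z | m x c z = c].
  have gP : closed_fam_of [set: T] D g.
    exists g => [c _|c _]; last by rewrite setTI.
    apply: closedI => //; apply: closed_eq_continuous => //.
    exact: continuous_median_arg.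
  have totD c d : D c -> D d -> m x c d = c \/ m x d c = d.
    move=> [->|[c' Ac' <-]] [->|[d' Ad' <-]]; first by left; exact: median_yxx.
    + by left; have [] := svalP d'.
    + by right; have [] := svalP c'.
    + by have [/asboolP|/asboolP] := totA _ _ Ac' Ad'; [left|right].
  have DK c : D c -> K c.
    by move=> [->//|[c' _ <-]]; have [] := svalP c'.
  have maxD (s : seq T) : (forall c, c \in s -> D c) ->
      exists2 d, D d & forall c, c \in s -> m x c d = c.
    elim: s => [_|c s IHs sD]; first by exists k0 => //; left.
    have [c' c's|d Dd sd] := IHs; first by apply: sD; rewrite inE c's orbT.
    have Dc : D c by apply: sD; rewrite inE eqxx.
    have [cd|dc] := totD _ _ Dc Dd.
      by exists d => // e /[!inE] /predU1P[->//|/sd].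
    exists c => // e /[!inE] /predU1P[->|/sd ed]; first exact: median_yxx.
    exact: (median_le_trans M ed).
  have fg : finI D g.
    move=> D' D'D.
    have [c cD'|d Dd sd] := maxD (enum_fset D').
      by apply/set_mem/D'D.
    by exists d => c cD'; split; [exact: DK|exact: sd].
  have := sclocc_compact Mm; rewrite compact_In0 => /(_ _ _ _ gP fg)[z Dz].
  have Ez : K z /\ m x k0 z = k0 by apply: (Dz k0); left.
  exists (exist _ z Ez) => s As; apply/asboolP => /=.
  by have [_] := Dz (sval s) (or_intror (ex_intro2 _ _ s As erefl)).
- move=> [k [Kk k0k]] kmax; exists k; split => // z Kz kz.
  have k0z : m x k0 z = k0 by exact: (median_le_trans M k0k).
  have := kmax (exist _ z (conj Kz k0z)).
  by move=> /(_ (asboolT kz)) [].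
Qed.

(** The join of [a] and [b] in the lattice between [x] and [y] is [m a b y]; it
lies between [a] and [b], so convex sets are closed under it. *)
Lemma closure_join x y (V : set T) : median_convex m V ->
  let D := closure (V `&` [set z | m x y z = z]) in
  forall a b, D a -> D b -> D (m a b y).
Proof.
move=> /(median_convexP M) cV D a b Da Db N mN.
have cm := topological_median_continuous (sclocc_topological Mm).
have /= : (fun q : T * T => m q.1 q.2 y) @ (nbhs (a, b)) --> m a b y.
  have ay : (fun q : T * T => (q, y)) @ (a, b) --> ((a, b), y).
    exact: (cvg_pair (@cvg_id _ (nbhs (a, b))) (cvg_cst y)).
  exact: (cvg_comp _ _ ay (cm _)).
move=> /(_ _ mN) [[P Q] /= [Pa Qb] PQ].
have [a' [[Va' a'y] Pa']] := Da _ Pa.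
have [b' [[Vb' b'y] Qb']] := Db _ Qb.
exists (m a' b' y); split; last exact: (PQ (a', b')).
split; first exact: cV.
by rewrite /= (medianM M) a'y b'y (median_yxx M).
Qed.

(** Let [V] and [U] be disjoint open convex neighborhoods of [x] and [y].  The
closure of the trace of [V] on the interval is closed under joins, so it has a
greatest element [v], which is not in [U].  Take [p] above [v] and maximal
outside [U]: if [a] and [b] are not below [p], the joins of [p] with [a] and
with [b] are in [U], hence so is their meet, which would be [p] if the meet
of [a] and [b] were below [p].  So [p] is meet-prime. *)
Lemma closed_halfspace_nbhs (x y : T) : x <> y ->
  exists p, let H := [set z | m x p z = m x y z] in
    [/\ m x y p = p, p <> y, halfspace m H, closed H & nbhs x H].
Proof.
move=> xy.
have := topological_median_hausdorff (sclocc_topological Mm).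
rewrite open_hausdorff => /(_ x y) [|[A B] /=]; first exact/eqP.
rewrite !inE => -[Ax By] [oA oB AB0].
have loc := sclocc_locally_open_convex Mm.
have [V [oV cV Vx VA]] := loc x A (open_nbhs_nbhs (conj oA Ax)).
have [U [oU cU Uy UB]] := loc y B (open_nbhs_nbhs (conj oB By)).
have VU z : V z -> ~ U z.
  move=> /VA Az /UB Bz; have : (A `&` B) z by [].
  by rewrite AB0.
pose L := [set z | m x y z = z].
have clL : closed L.
  by apply: closed_eq_continuous => //; exact: continuous_median_arg.
pose D := closure (V `&` L).
pose K := L `&` ~` U.
have clK : closed K by apply: closedI => //; exact: open_closedC.
have DK : D `<=` K.
  apply: subset_trans (clK); apply: closure_subset => z [Vz Lz].
  by split => //; exact: VU.
have Dx : D x by apply: subset_closure; split => //; exact: median_xyx.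
have [v [Dv _ vmax]] := compact_maximal x (@closed_closure _ _) Dx.
(* A maximal element of [D] is its greatest element, since [D] has joins. *)
have Dle d : D d -> m x d v = d.
  move=> Dd; have [[Ld _] [Lv _]] := (DK _ Dd, DK _ Dv).
  have Lv' : m x v y = v by rewrite (median_swap23 M).
  have Ld' : m x d y = d by rewrite (median_swap23 M).
  have <- : m d v y = v.
    apply: vmax; first exact: (closure_join cV).
    by rewrite (medianM M) Lv' (median_yxx M) (median_yxx M).
  by rewrite (medianM M) Ld' (median_yxx M) (median_xyx M).
have [p [[Lp Up] vp pmax]] := compact_maximal x clK (DK _ Dv).
have Lp' : m x p y = p by rewrite (median_swap23 M).
exists p; split => //.
- by move=> py; apply: Up; rewrite py.
- apply: (halfspace_prime M Lp) => a b La Lb abp.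
  have La' : m x a y = a by rewrite (median_swap23 M).
  have Lb' : m x b y = b by rewrite (median_swap23 M).
  have joinU c : m x y c = c -> m x c y = c -> m x p c <> c -> U (m p c y).
    move=> Lc Lc' cp; apply: contrapT => Uc; apply: cp.
    have <- : m p c y = p.
      apply: pmax; last by rewrite (medianM M) Lp' (median_yxx M) (median_xyx M).
      by split => //=; rewrite /L /= (medianM M) Lp Lc (median_yxx M).
    by rewrite (median_swap23 M) (medianM M) Lc' (median_yxx M) (median_yxx M).
  apply: contrapT => /not_orP[pa pb].
  move/(median_convexP M) : cU => cU.
  have := cU _ _ x (joinU a La La' pa) (joinU b Lb Lb' pb).
  rewrite -(median_rot M x) !(median_swap23 M p _ y) -(median_distr1 M).
  rewrite -abp (medianM M) -(median_rot M x) Lp' (median_xyx M) (median_xx M).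
  exact: Up.
- by apply: closed_eq_continuous; exact: continuous_median_arg.
- have cxy : continuous (fun z => m x y z) by exact: continuous_median_arg.
  have : nbhs x ((fun z => m x y z) @^-1` V).
    by apply: (cxy x); rewrite (median_xyx M); exact: open_nbhs_nbhs.
  apply: filterS => z /= Vz.
  have Dz : D (m x y z).
    by apply: subset_closure; split => //; exact: (median_idem M).
  have := median_le_trans M (Dle _ Dz) vp.
  rewrite (median_swap23 M) (medianM M) (median_xyx M).
  by rewrite (median_swap23 M x p y) Lp (median_idem M).
Qed.

(** The first halfspace consists of points whose projection to the interval
between [x] and [y] lies between [x] and [p].  They project to the endpoint [p]
of the interval between [y] and [p], which the second halfspace excludes. *)
Lemma disjoint_closed_halfspaces (x y : T) : x <> y -> exists H K : set T,
  [/\ halfspace m H /\ halfspace m K, closed H /\ closed K,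
      nbhs x H, nbhs y K & H `&` K = set0].
Proof.
move=> /closed_halfspace_nbhs[p [pxy py hH cH xH]].
have /closed_halfspace_nbhs[q [qyp qp hK cK yK]] : y <> p by move=> /esym.
eexists _, _; split; [split; [exact: hH|exact: hK]|by []|by []|by []|].
apply/seteqP; split=> // z [/= Hz Kz].
have zp : m y p z = p.
  have : m y p (m x p z) = p.
    by rewrite (medianM M) (median_yxx M) -(median_rot M x) pxy (median_xx M).
  rewrite Hz (medianM M) (median_xyx M) -(median_rot M x).
  by rewrite pxy (median_swap12 M p y) (median_idem M).
apply: qp; rewrite -qyp (median_swap23 M) -[in LHS]zp -Kz.
by rewrite (median_idem M) Kz.
Qed.


End TopologicalMedianAlgebra.

(** * Balanced measures on halfspaces *)

Section BalancedMeasure.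
Local Open Scope ring_scope.

(** An event that depends on three independent points only through the fibers of
[g] containing them is a finite disjoint union of boxes. *)
Lemma cube_measure_fibers d (T : measurableType d) (R : realType)
    (mu : probability T R) (J : finType) (g : T -> J) (P : J -> J -> J -> bool) :
  (forall j, measurable (g @^-1` [set j])) ->
  let q j := fine (mu (g @^-1` [set j])) in
  ((mu \x mu) \x mu)%E [set z | P (g z.1.1) (g z.1.2) (g z.2)] =
  (\sum_i \sum_j \sum_k (if P i j k then q i * q j * q k else 0))%:E.
Proof.
move=> mg q.
pose box (t : J * J * J) : set (T * T * T) :=
  (g @^-1` [set t.1.1] `*` g @^-1` [set t.1.2]) `*` g @^-1` [set t.2].
pose r := [seq t <- index_enum (J * J * J)%type | P t.1.1 t.1.2 t.2].
have -> : [set z | P (g z.1.1) (g z.1.2) (g z.2)] = \bigcup_(t in [set` r]) box t.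
  apply/seteqP; split=> [z /= Pz|z [t]].
    by exists (g z.1.1, g z.1.2, g z.2) => //; rewrite /= mem_filter /= Pz mem_index_enum.
  rewrite /= mem_filter => /andP[Pt _] [[/= e1 e2] e3].
  by move: Pt; rewrite -e1 -e2 -e3.
rewrite measure_fin_bigcup//=; last 2 first.
- move=> [[i j] k] [[i' j'] k'] _ _ [z [[[/= e1 e2] e3] [[/= e1' e2'] e3']]].
  by rewrite -e1 -e2 -e3 e1' e2' e3'.
- by move=> t _; do 2?apply: measurableX.
rewrite -fsbig_seq ?filter_uniq ?index_enum_uniq// big_filter.
have boxE t : ((mu \x mu) \x mu)%E (box t) = (q t.1.1 * q t.1.2 * q t.2)%:E.
  have m12 := measurableX (mg t.1.1) (mg t.1.2).
  rewrite /box (product_measure1E (mu \x mu)%E mu m12 (mg t.2)).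
  have /= -> := product_measure1E mu mu (mg t.1.1) (mg t.1.2).
  by rewrite !EFinM !fineK// fin_num_measure.
under eq_bigr do rewrite boxE.
rewrite sumEFin big_mkcond/=; congr _%:E.
rewrite [in RHS]pair_bigA/= [in RHS]pair_bigA/=.
by apply: eq_bigr => -[[i j] k].
Qed.

Lemma big_bool_pair (R : nmodType) (F : bool * bool -> R) :
  \sum_i F i =
  F (true, true) + F (true, false) + (F (false, true) + F (false, false)).
Proof.
rewrite (eq_bigr (fun p => F (p.1, p.2))) => [|[]//].
by rewrite -(pair_bigA _ (fun a b => F (a, b)))/= !big_bool.
Qed.

Lemma pair_majority_sum (R : comRingType) (q : bool * bool -> R) :
  let n (i j k : bool * bool) := (majority i.1 j.1 k.1, majority i.2 j.2 k.2) in
  \sum_i \sum_j \sum_k (if n i j k == (true, true) then q i * q j * q k else 0) =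
  q (true, true) ^+ 3
  + 3 * q (true, true) ^+ 2
    * (q (true, false) + q (false, true) + q (false, false))
  + 6 * q (true, true) * q (true, false) * q (false, true).
Proof. by move=> n; rewrite !big_bool_pair/=; ring. Qed.

Lemma mem_eqP (U : Type) (A : set U) b z :
  (z \in A) = b <-> (if b then A else ~` A) z.
Proof.
case: b; first by split=> [/set_mem|/mem_set].
by split=> [zA /mem_set|nzA]; [rewrite zA|exact: memNset].
Qed.

Lemma fine_measureC d (T : measurableType d) (R : realType)
    (mu : probability T R) (A : set T) :
  measurable A -> fine (mu (~` A)) = 1 - fine (mu A).
Proof.
move=> mA; rewrite probability_setC// fineB//; exact: fin_num_measure.
Qed.

Lemma fine_measureIC d (T : measurableType d) (R : realType)
    (mu : probability T R) (A B : set T) : measurable A -> measurable B ->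
  fine (mu (A `&` ~` B)) = fine (mu A) - fine (mu (A `&` B)).
Proof.
move=> mA mB; rewrite -setDE measureD ?fineB//; try exact: fin_num_measure.
  by apply: fin_num_measure; exact: measurableI.
by rewrite -ge0_fin_numE//; exact: fin_num_measure.
Qed.

Context (R : realType) (T : ptopologicalType) (m : T -> T -> T -> T).
Context (mu : probability (borel T) R) (mu_balanced : balanced m mu).

(** A median morphism to a finite algebra pushes a balanced measure to a balanced
one, whose masses [q] satisfy a system of cubic equations. *)
Lemma balanced_fibers (J : finType) (n : J -> J -> J -> J) (g : borel T -> J) :
  median_morphism m n g -> (forall j, measurable (g @^-1` [set j])) ->
  let q j := fine (mu (g @^-1` [set j])) in
  forall j, q j = \sum_i \sum_k \sum_l (if n i k l == j then q i * q k * q l else 0).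
Proof.
move=> gM mg q j; apply: EFin_inj.
rewrite -(cube_measure_fibers mu (fun i k l => n i k l == j) mg).
rewrite /q fineK; last exact: fin_num_measure.
rewrite -(mu_balanced (mg j)) /self_median /pushforward; congr (_ _).
by apply/seteqP; split=> -[[a b] c]; rewrite /uncurry3 /= gM => /eqP.
Qed.

Lemma balanced_halfspace (A : set (borel T)) : measurable A -> halfspace m A ->
  let p := fine (mu A) in [\/ p = 0, p = 2^-1 | p = 1].
Proof.
move=> mA hA p.
have AE b : (fun z => z \in A) @^-1` [set b] = if b then A else ~` A.
  by apply/seteqP; split=> z /mem_eqP.
have AT := AE true; have AF := AE false.
have /= := balanced_fibers hA _ true.
rewrite !big_bool/= AT AF fine_measureC// -/p => pE.
have {pE} : p * ((p - 2^-1) * (p - 1)) = 0.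
  have /pE : forall j, measurable ((fun z => z \in A) @^-1` [set j] : set (borel T)).
    by move=> [|]; rewrite ?AT ?AF//; exact: measurableC.
  lra.
move/eqP; rewrite !mulf_eq0 !subr_eq0 => /or3P[]/eqP->.
- exact: Or31.
- exact: Or32.
- exact: Or33.
Qed.

(** The four masses of the pair of indicators are [t], [1/2 - t], [1/2 - t] and
[t], and the cubic equation for [t] has the roots [0], [1/4] and [1/2].  In terms
of the correlation [r = 4 t - 1] it reads [r^3 = r]. *)
Lemma balanced_halfspace_pair (A B : set (borel T)) :
  measurable A -> measurable B -> halfspace m A -> halfspace m B ->
  fine (mu A) = 2^-1 -> fine (mu B) = 2^-1 ->
  let t := fine (mu (A `&` B)) in [\/ t = 0, t = 2^-1 | t = 4^-1].
Proof.
move=> mA mB hA hB pA pB t.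
pose g (z : borel T) := (z \in A, z \in B).
pose n (i j k : bool * bool) := (majority i.1 j.1 k.1, majority i.2 j.2 k.2).
have gM : median_morphism m n g by move=> a b c; rewrite /g hA hB.
have gE (a b : bool) : g @^-1` [set (a, b)] =
    (if a then A else ~` A) `&` (if b then B else ~` B).
  apply/seteqP; split=> [z [/mem_eqP ? /mem_eqP ?] //|z [/mem_eqP ? /mem_eqP ?]].
  by rewrite /g /=; congr (_, _).
have mg j : measurable (g @^-1` [set j]).
  by case: j => -[] []; rewrite gE; apply: measurableI => //; exact: measurableC.
pose q j := fine (mu (g @^-1` [set j])).
have : q (true, true) = _ :=
  etrans (balanced_fibers gM mg (true, true)) (pair_majority_sum q).
rewrite /q !gE.
have qtf : fine (mu (A `&` ~` B)) = 2^-1 - t by rewrite fine_measureIC// pA.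
have qft : fine (mu (~` A `&` B)) = 2^-1 - t.
  by rewrite setIC fine_measureIC// pB setIC.
have qff : fine (mu (~` A `&` ~` B)) = t.
  rewrite fine_measureIC//; last exact: measurableC.
  by rewrite qft fine_measureC// pA; lra.
rewrite qtf qft qff -/t => tE.
have {tE} : t * ((t - 2^-1) * (t - 4^-1)) = 0 by lra.
move/eqP; rewrite !mulf_eq0 !subr_eq0 => /or3P[]/eqP->.
- exact: Or31.
- exact: Or32.
- exact: Or33.
Qed.

End BalancedMeasure.

(** * Recognizing cubes *)

Section Cube.
Context (T : ptopologicalType) (m : T -> T -> T -> T) (Mm : sclocc m).

Let M : median_algebra m := topological_median (sclocc_topological Mm).

Lemma compact_finite_bigcap (I : choiceType) (A : set T) (C : I -> set T) :
  compact A -> (forall i, closed (C i)) ->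
  (forall s : seq I, exists2 z, A z & forall i, i \in s -> C i z) ->
  exists2 z, A z & forall i, C i z.
Proof.
rewrite compact_In0 => cA clC finC.
(* The extra index makes the bare set [A] a member of the family, so that the
   intersection lies in [A] even when [I] is empty. *)
pose g (i : option I) := if i is Some i then A `&` C i else A `&` setT.
have [|D' _|z gz] := cA _ [set: option I] g.
- exists (fun i => if i is Some i then C i else setT) => [|] [i|] _ //.
- have [z Az Cz] := finC (pmap id (enum_fset D')).
  exists z => -[i|] //= iD'; split => //; apply: Cz.
  by rewrite mem_pmap map_id.
- have [Az _] : g None z by exact: gz.
  by exists z => // i; have [] : g (Some i) z by exact: gz.
Qed.

(** Helly property: three convex sets that meet pairwise have a common point, the
median of points of the three pairwise intersections.  Intersecting [D] with
one member at a time carries this to any finite family; [D] is only convex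
relative to [S], which makes the induction work inside the subalgebra [S]. *)
Lemma helly (S : set T) (I : eqType) (C : I -> set T) (s : seq I) (D : set T) :
  D `<=` S -> (forall a b c, D a -> D b -> S c -> D (m a b c)) ->
  (forall i, median_convex m (C i)) ->
  (forall i, i \in s -> exists2 z, D z & C i z) ->
  (forall i j, i \in s -> j \in s -> exists2 z, S z & C i z /\ C j z) ->
  D !=set0 -> exists2 z, D z & forall i, i \in s -> C i z.
Proof.
move=> + + cC; elim: s D => [|i s IHs] D DS cD Ds ss [z0 Dz0].
  by exists z0.
have cC' j := (median_convexP M (C j)).1 (cC j).
have [a Da Cia] := Ds i (mem_head _ _).
have [| | | | |z [Dz Ciz] sz] := IHs (D `&` C i).
- by move=> z [/DS].
- by move=> u v w [Du Cu] [Dv Cv] Sw; split; [exact: cD|exact: cC'].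
- move=> j js; have js' : j \in i :: s by rewrite inE js orbT.
  have [b Db Cjb] := Ds j js'.
  have [c Sc [Cic Cjc]] := ss i j (mem_head _ _) js'.
  exists (m a b c); last by rewrite (median_rot M); exact: cC'.
  by split; [exact: cD|rewrite (median_swap23 M); exact: cC'].
- by move=> j k js ks; apply: ss; rewrite inE ?js ?ks orbT.
- by exists a.
by exists z => // j /[!inE] /predU1P[->//|]; exact: sz.
Qed.

(** The two sides of the wall [i] are [F i true] and [F i false].  A choice [w] of
sides has a common point in [S] by the Helly property and compactness, and only
one by separation; sending [w] to this point parametrizes [S] by a cube. *)
Lemma is_cube_walls (S : set T) (I : choiceType) (F : I -> bool -> set T) :
  countable [set: I] -> closed S -> S !=set0 ->
  (forall a b c, S a -> S b -> S c -> S (m a b c)) ->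
  (forall i b, closed (F i b)) -> (forall i b, median_convex m (F i b)) ->
  (forall i, F i true `&` F i false = set0) ->
  (forall i, S `<=` F i true `|` F i false) ->
  (forall x y, S x -> S y -> (forall i, F i true x <-> F i true y) -> x = y) ->
  (forall i b, exists2 z, S z & F i b z) ->
  (forall i j b c, i != j -> exists2 z, S z & F i b z /\ F j c z) ->
  is_cube m S.
Proof.
move=> cI clS S0 mS clF cF F0 SF Fsep Fi Fij.
have compS : compact S.
  by apply: (subclosed_compact clS (sclocc_compact Mm)).
have F1 i b x : F i b x -> F i (~~ b) x -> False.
  have Fx : ~ (F i true `&` F i false) x by rewrite F0.
  by case: b => /= ? ?; apply: Fx.
have Funiq x y (w : I -> bool) : S x -> S y ->
    (forall i, F i (w i) x) -> (forall i, F i (w i) y) -> x = y.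
  move=> Sx Sy wx wy; apply: Fsep => // i.
  move: (wx i) (wy i); case: (w i) => // x0 y0.
  by split=> [x1|y1]; [case: (F1 i true x)|case: (F1 i true y)].
have pt (w : I -> bool) : exists z, S z /\ forall i, F i (w i) z.
  have [||z Sz wz] := @compact_finite_bigcap I S (fun i => F i (w i)) compS.
  - by move=> i.
  - move=> s; apply: (@helly S) => // i j _ _.
    have [->|ij] := eqVneq i j; last exact: Fij.
    by have [z Sz jz] := Fi j (w j); exists z.
  by exists z.
have [f fP] := choice pt.
exists I, f; split => //.
- move=> u v uv; apply/funext => i; have [_ /(_ i) ui] := fP u.
  have [_ /(_ i)] := fP v; rewrite -uv => vi.
  by case: (u i) (v i) ui vi => -[] // ? ?; case: (@F1 i true (f u)).
(* If [w] had no neighborhood mapped into [U], compactness would give a point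
   of [S] outside [U] on the same sides as [f w], hence equal to [f w]. *)
- move=> w N; rewrite nbhsE => -[U [oU Uw] UN].
  apply: contrapT => wN.
  have [|||z [Sz Uz] wz] := @compact_finite_bigcap I (S `&` ~` U) (fun i => F i (w i)).
  + apply: subclosed_compact compS _; last by move=> z [].
    by apply: closedI => //; exact: open_closedC.
  + by [].
  + move=> s; apply: contrapT => nz; apply: wN.
    have : \forall v \near (w : {ptws I -> bool}), forall i, i \in s -> v i = w i.
      have nb i : \forall v \near (w : {ptws I -> bool}), v i = w i.
        exact: (@proj_continuous I (fun=> bool) i w [set w i]).
      elim: s {nz} => [|i s IHs]; first by near=> v.
      near=> v => j /[!inE] /predU1P[->|js]; first by near: v; exact: nb.
      by move: j js; near: v; exact: IHs.
    apply: filterS => v vw /=; apply: UN; apply: contrapT => Uv.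
    have [Sv Fv] := fP v; apply: nz; exists (f v) => // i si.
    by rewrite -(vw i si).
  + by apply: Uz; have [Sw Fw] := fP w; rewrite (Funiq z (f w) w).
- move=> u v w; have [[Su Fu] [Sv Fv] [Sw Fw]] := And3 (fP u) (fP v) (fP w).
  have [Sm Fm] := fP (cube_median u v w).
  apply: (Funiq _ _ (cube_median u v w)) => //; first exact: mS.
  move=> i; move: (Fu i) (Fv i) (Fw i); rewrite /cube_median.
  have cC b := (median_convexP M (F i b)).1 (cF i b).
  case: (u i) (v i) (w i) => -[] [] /= a b c.
  + exact: cC.
  + exact: cC.
  + by rewrite (median_swap23 M); exact: cC.
  + by rewrite (median_rot M); exact: cC.
  + by rewrite (median_rot M); exact: cC.
  + by rewrite (median_swap23 M); exact: cC.
  + exact: cC.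
  + exact: cC.
- apply/seteqP; split=> [z Sz|_ [w _ <-]]; last by have [] := fP w.
  pose w i := z \in F i true; exists w => //.
  have [Sw Fw] := fP w; apply: (Funiq _ _ w) => // i.
  rewrite /w; case: (boolP (z \in F i true)) => [/set_mem//|].
  by rewrite notin_setE => nz; have [] := SF i z Sz.
Unshelve. all: by end_near. Qed.

End Cube.

(** * The support of a balanced measure *)

Section BalancedSupport.
Context (R : realType) (T : ptopologicalType) (m : T -> T -> T -> T).
Context (Mm : sclocc m) (mu : probability (borel T) R).
Context (mu_balanced : balanced m mu).

Let M : median_algebra m := topological_median (sclocc_topological Mm).
Let S : set T := measure_support mu.

Lemma borel_closed (C : set T) : closed C -> measurable (C : set (borel T)).
Proof.
move=> cC; rewrite -(setCK C); apply: measurableC.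
exact: (borel_open (closed_openC cC)).
Qed.

Lemma measure_support_open (U : set T) x : open U -> U x -> S x -> mu U <> 0%E.
Proof.
move=> oU Ux Sx U0; have := @measure_support_min R T mu (~` U).
by rewrite setCK => /(_ (open_closedC oU) U0 x Sx).
Qed.

Lemma fine_measure_nbhs (A : set T) x : measurable (A : set (borel T)) ->
  nbhs x A -> S x -> fine (mu A) <> 0%R.
Proof.
move=> mA; rewrite nbhsE => -[U [oU Ux] UA] Sx A0.
apply: (measure_support_open oU Ux Sx).
apply: (subset_measure0 (mu := mu) _ _ UA) => //; first exact: borel_open.
by rewrite -[LHS]fineK ?A0// fin_num_measure.
Qed.

Lemma eq_measure_support (A B : set T) :
  measurable (A : set (borel T)) -> measurable (B : set (borel T)) ->
  A `&` S = B `&` S -> mu A = mu B.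
Proof.
have mS : measurable (S : set (borel T)).
  by apply: borel_closed; exact: closed_measure_support.
have AS (C : set T) : measurable (C : set (borel T)) -> mu C = mu (C `&` S).
  move=> mC; rewrite (measureDI mu mC mS).
  rewrite [X in (X + _)%E](_ : _ = 0%E) ?add0e//.
  apply: (@subset_measure0 _ _ _ mu _ (~` S)); last 1 first.
  - exact: (measure_support_conull mu (sclocc_second_countable Mm)).
  - exact: measurableD.
  - exact: measurableC.
  - by move=> z [].
by move=> mA mB AB; rewrite AS// AB -AS.
Qed.

(** If the median of three points of the support avoided the support, so would the
medians of all triples in a box of positive measure around them. *)
Lemma measure_support_median x y z : S x -> S y -> S z -> S (m x y z).
Proof.
move=> Sx Sy Sz; apply: contrapT => nS.
have cm := topological_median_continuous (sclocc_topological Mm).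
have oS : open (~` S) by apply: closed_openC; exact: closed_measure_support.
have := cm (x, y, z) (~` S) (open_nbhs_nbhs (conj oS nS)).
move=> [[P Q] /= [[[P1 P2] /= [xP1 yP2] P12] zQ] PQ].
move: xP1 yP2 zQ; rewrite !nbhsE.
move=> [U1 [oU1 U1x] UP1] [U2 [oU2 U2y] UP2] [U3 [oU3 U3z] UQ].
have box0 : ((mu \x mu) \x mu)%E ((U1 `*` U2) `*` U3) = 0%E.
  apply: (@subset_measure0 _ _ _ ((mu \x mu) \x mu)%E _ (uncurry3 m @^-1` (~` S))).
  - by do 2?apply: measurableX; exact: borel_open.
  - rewrite -[X in measurable X]setTI.
    apply: (measurable_median (sclocc_second_countable Mm) cm) => //.
    exact: borel_open.
  - move=> [[a b] c] [[/= Ua Ub] Uc]; apply: (PQ (a, b, c)); split; last exact: UQ.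
    by apply: (P12 (a, b)); split; [exact: UP1|exact: UP2].
  - apply: (etrans (mu_balanced (borel_open oS))).
    exact: (measure_support_conull mu (sclocc_second_countable Mm)).
have mU12 := measurableX (borel_open oU1) (borel_open oU2).
move: box0; rewrite (product_measure1E (mu \x mu)%E mu mU12 (borel_open oU3)).
have /= -> := product_measure1E mu mu (borel_open oU1) (borel_open oU2).
move/eqP; rewrite !mule_eq0 => /orP[/orP[]|] /eqP.
- exact: measure_support_open U1x Sx.
- exact: measure_support_open U2y Sy.
- exact: measure_support_open U3z Sz.
Qed.

(** The two sides cover the support only; elsewhere they may leave a gap. *)
Definition support_wall (H K : set T) : Prop :=
  [/\ halfspace m H /\ halfspace m K, closed H /\ closed K, H `&` K = set0,
      S `<=` H `|` K & (S `&` H) !=set0 /\ (S `&` K) !=set0].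

Lemma support_wall_sym H K : support_wall H K -> support_wall K H.
Proof.
move=> [[hH hK] [cH cK] HK SHK [SH SK]]; split => //; first by rewrite setIC.
by rewrite setUC.
Qed.

(** On the support, a side [H] of a wall can be replaced by the open set [~` K].
This gives open sets, hence positive measure, from nonempty traces. *)
Lemma support_wall_setI H K (A : set T) : support_wall H K ->
  A `&` ~` K `&` S = A `&` H `&` S.
Proof.
move=> [_ _ HK SHK _]; apply/seteqP; split=> z [[Az Kz] Sz]; split => //; split => //.
  by have [] := SHK z Sz.
by move=> Kz'; have : (H `&` K) z by []; rewrite HK.
Qed.

Lemma halfspace_measure_half (H : set T) x y :
  measurable (H : set (borel T)) -> halfspace m H ->
  S x -> nbhs x H -> S y -> nbhs y (~` H) -> fine (mu H) = 2^-1%R.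
Proof.
move=> mH hH Sx xH Sy yH.
have [H0|//|H1] := balanced_halfspace mu_balanced mH hH.
  by case: (fine_measure_nbhs mH xH Sx).
case: (fine_measure_nbhs (measurableC mH) yH Sy).
by rewrite fine_measureC// H1 subrr.
Qed.

Lemma support_wall_measure H K : support_wall H K -> fine (mu H) = 2^-1%R.
Proof.
move=> HK; have [[hH hK] [cH cK] HK0 SHK [[x [Sx Hx]] [y [Sy Ky]]]] := HK.
have mH := borel_closed cH; have mK := borel_closed cK.
have nH : ~ H y by move=> Hy; have : (H `&` K) y by []; rewrite HK0.
have nK : ~ K x by move=> Kx; have : (H `&` K) x by []; rewrite HK0.
have HE : mu H = mu (~` K).
  apply: eq_measure_support => //; first exact: measurableC.
  by have := support_wall_setI setT HK; rewrite !setTI.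
have [H0|//|H1] := balanced_halfspace mu_balanced mH hH.
  have /(fine_measure_nbhs (measurableC mK))/(_ Sx) : nbhs x (~` K).
    by apply: open_nbhs_nbhs; split => //; exact: closed_openC.
  by rewrite -HE H0.
have /(fine_measure_nbhs (measurableC mH))/(_ Sy) : nbhs y (~` H).
  by apply: open_nbhs_nbhs; split => //; exact: closed_openC.
by rewrite fine_measureC// H1 subrr.
Qed.

(** Two disjoint halfspaces of measure [1/2] have a conull union; being closed, the
union contains the support. *)
Lemma exists_support_wall x y : S x -> S y -> x <> y ->
  exists H K, [/\ support_wall H K, H x & K y].
Proof.
move=> Sx Sy /(disjoint_closed_halfspaces Mm)[H [K]].
move=> [[hH hK] [cH cK] xH yK HK0].
have Hx := nbhs_singleton xH; have Ky := nbhs_singleton yK.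
have mH := borel_closed cH; have mK := borel_closed cK.
have KH : K `<=` ~` H.
  by move=> z Kz Hz; have : (H `&` K) z by []; rewrite HK0.
have HK : H `<=` ~` K by move=> z Hz Kz; exact: KH Hz.
have H2 := halfspace_measure_half mH hH Sx xH Sy (filterS KH yK).
have K2 := halfspace_measure_half mK hK Sy yK Sx (filterS HK xH).
exists H, K; split => //; split => //; last by split; [exists x|exists y].
apply: (@measure_support_min R T mu); first exact: closedU.
have mHK : measurable (~` (H `|` K) : set (borel T)).
  by apply: measurableC; exact: measurableU.
rewrite -[LHS]fineK ?fin_num_measure//; congr EFin.
rewrite setCU fine_measureIC//; last exact: measurableC.
by rewrite fine_measureC// (setIidr KH) H2 K2; lra.
Qed.

(** Measure [1/2] for the intersection of [H] and [H'] forces the same trace on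
the support, measure [1/4] makes the two walls independent, and measure [0] makes
[H] and [H'] complementary on the support, which the common point [s] of [K] and
[K'] excludes. *)
Lemma support_wall_cross H K H' K' s :
  support_wall H K -> support_wall H' K' -> S s -> K s -> K' s ->
  S `&` H <> S `&` H' ->
  [/\ mu (H `&` H') <> 0%E, mu (H `&` K') <> 0%E,
      mu (K `&` H') <> 0%E & mu (K `&` K') <> 0%E].
Proof.
have q0 : ((4%:R)^-1 : R)%R <> 0%R by move=> ?; lra.
have q1 : ((2%:R)^-1 - (4%:R)^-1 : R)%R <> 0%R by move=> ?; lra.
move=> HK HK' Ss Ks Ks' neq.
have [[hH hK] [cH cK] HK0 SHK _] := HK.
have [[hH' hK'] [cH' cK'] HK0' SHK' _] := HK'.
have mH := borel_closed cH; have mK := borel_closed cK.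
have mH' := borel_closed cH'; have mK' := borel_closed cK'.
have H2 := support_wall_measure HK.
have H2' := support_wall_measure HK'.
have nH : ~ H s by move=> Hs; have : (H `&` K) s by []; rewrite HK0.
have nH' : ~ H' s by move=> Hs; have : (H' `&` K') s by []; rewrite HK0'.
pose t := fine (mu (H `&` H')).
have tE : fine (mu (H `&` H')) = t by [].
have eHK' : fine (mu (H `&` K')) = (2^-1 - t)%R.
  rewrite -(@eq_measure_support (H `&` ~` H')) ?fine_measureIC ?H2//.
  - by apply: measurableI => //; exact: measurableC.
  - exact: measurableI.
  - exact: (support_wall_setI _ (support_wall_sym HK')).
have eKH' : fine (mu (K `&` H')) = (2^-1 - t)%R.
  rewrite setIC -(@eq_measure_support (H' `&` ~` H)).
  - by rewrite fine_measureIC// H2' setIC.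
  - by apply: measurableI => //; exact: measurableC.
  - exact: measurableI.
  - exact: (support_wall_setI _ (support_wall_sym HK)).
have eKK' : fine (mu (K `&` K')) = t.
  rewrite -(@eq_measure_support (K `&` ~` H')) ?fine_measureIC//.
  - by rewrite eKH' (support_wall_measure (support_wall_sym HK)); lra.
  - by apply: measurableI => //; exact: measurableC.
  - exact: measurableI.
  - exact: (support_wall_setI _ (support_wall_sym HK')).
(* A null intersection of two sides has empty trace, as it agrees on the
   support with an open set. *)
have sub A B A' B' : support_wall A B -> support_wall A' B' ->
    fine (mu (A `&` B')) = 0%R -> S `&` A `<=` A'.
  move=> AB AB'; have [_ [cA cB] AB0 _ _] := AB; have [_ [cA' cB'] _ _ _] := AB'.
  have oBA' : open (~` B `&` ~` A').
    by apply: openI; exact: closed_openC.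
  have -> : mu (A `&` B') = mu (~` B `&` ~` A').
    apply: eq_measure_support; last 1 first.
    - rewrite (support_wall_setI (~` B) (support_wall_sym AB')) (setIC (~` B)).
      by rewrite (support_wall_setI B' AB) (setIC B').
    - by apply: measurableI; exact: borel_closed.
    - exact: borel_open.
  move=> AB'0 z [Sz Az]; apply: contrapT => A'z.
  apply: (fine_measure_nbhs (borel_open oBA') _ Sz AB'0).
  apply: open_nbhs_nbhs; split => //; split => // Bz.
  by have : (A `&` B) z by []; rewrite AB0.
have := balanced_halfspace_pair mu_balanced mH mH' hH hH' H2 H2'.
rewrite tE => -[t0|t2|t4].
- case: nH'; apply: (sub K H H' K') => //; first exact: support_wall_sym.
  by rewrite eKK'.
- case: neq; apply/seteqP; split=> z Az; have [Sz _] := Az; split => //.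
    by apply: (sub H K H' K') => //; rewrite eHK' t2 subrr.
  by apply: (sub H' K' H K) => //; rewrite setIC eKH' t2 subrr.
- split=> A0.
  + by apply: q0; rewrite -t4 -tE A0.
  + by apply: q1; rewrite -t4 -eHK' A0.
  + by apply: q1; rewrite -t4 -eKH' A0.
  + by apply: q0; rewrite -t4 -eKK' A0.
Qed.

Lemma measure_support_meets (A : set T) : measurable (A : set (borel T)) ->
  mu A <> 0%E -> exists2 z, S z & A z.
Proof.
move=> mA A0; apply: contrapT => nA; apply: A0.
rewrite (@eq_measure_support A set0)// set0I; apply/seteqP; split=> // z [Az Sz].
by case: nA; exists z.
Qed.

Lemma measure_support_nonempty : S !=set0.
Proof.
have [|z Sz _] := @measure_support_meets setT measurableT; last by exists z.
by rewrite probability_setT => /eqP; rewrite onee_eq0.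
Qed.

(** One side [H] of a wall is compact and disjoint from the closed set [K], so
finitely many basic open sets cover [H] and miss [K]; their union has the same
trace on the support as [H]. *)
Lemma countable_wall_traces :
  countable [set a | exists H K, support_wall H K /\ a = S `&` H].
Proof.
have [B cB [oB nbB]] := sclocc_second_countable Mm.
pose trace (D : {fset (set T)}) := S `&` \bigcup_(V in [set` D]) V.
have cD : countable (trace @` [set D : {fset (set T)} | {subset D <= B}]).
  apply: (card_le_trans (card_image_le _ _)); exact: fset_subset_countable.
apply: sub_countable cD.
apply: subset_card_le => a [H [K [[_ [cH cK] HK0 SHK _] ->]]].
have : compact H by apply: (subclosed_compact cH (sclocc_compact Mm)).
rewrite compact_cover.
move=> /(_ _ [set V | B V /\ V `&` K = set0] id)[].
- by move=> V [/oB].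
- move=> z Hz; have /nbB [V [BV Vz] VK] : nbhs z (~` K).
    apply: open_nbhs_nbhs; split; first exact: closed_openC.
    by move=> Kz; have : (H `&` K) z by []; rewrite HK0.
  exists V => //; split => //; apply/seteqP; split=> // y [Vy Ky].
  exact: (VK y Vy).
- move=> D DB HD; exists D => [V /DB /set_mem [BV _]|]; first exact/mem_set.
  apply/seteqP; split=> z [Sz]; last by move=> Hz; split => //; exact: HD.
  move=> [V /DB /set_mem [_ VK] Vz]; split => //.
  by have [//|Kz] := SHK z Sz; have : (V `&` K) z by []; rewrite VK.
Qed.

Lemma is_cube_support : is_cube m S.
Proof.
have [s Ss] := measure_support_nonempty.
(* Indexing by the trace of the side that avoids [s] picks one index for each
   wall of the support: a set and its complement are never both indices. *)
pose P := [set a : set T | exists H K, [/\ support_wall H K, a = S `&` H & K s]].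
have wallP (a : set T) : exists HK : set T * set T,
    P a -> [/\ support_wall HK.1 HK.2, a = S `&` HK.1 & HK.2 s].
  have [[H [K HK]]|nP] := pselect (P a); first by exists (H, K).
  by exists (set0, set0).
have [w wP] := choice wallP.
pose F (i : set_type P) (b : bool) := if b then (w (val i)).1 else (w (val i)).2.
have FP i : [/\ support_wall (F i true) (F i false), val i = S `&` F i true & F i false s].
  by apply: wP; exact: (set_mem (valP i)).
have meets A B : closed A -> closed B -> mu (A `&` B) <> 0%E ->
    exists2 z, S z & A z /\ B z.
  move=> cA cB; apply: measure_support_meets.
  by apply: measurableI; exact: borel_closed.
apply: (is_cube_walls Mm (F := F)).
- rewrite (eq_countable (card_setT P)).
  apply: sub_countable countable_wall_traces; apply: subset_card_le.
  by move=> a [H [K [HK aE _]]]; exists H, K.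
- exact: closed_measure_support.
- by exists s.
- exact: measure_support_median.
- by move=> i [|]; have [[_ [cH cK] _ _ _] _ _] := FP i.
- by move=> i [|]; have [[[hH hK] _ _ _ _] _ _] := FP i; exact: halfspace_convex.
- by move=> i; have [[]] := FP i.
- by move=> i; have [[]] := FP i.
- move=> x y Sx Sy Fxy; apply: contrapT => xy.
  have [H [K [HK Hx Ky]]] := exists_support_wall Sx Sy xy.
  have [_ _ HK0 SHK _] := HK.
  have disj z : H z -> K z -> False.
    by move=> Hz Kz; have : (H `&` K) z by []; rewrite HK0.
  have side A B : support_wall A B -> B s -> A x <-> A y.
    move=> AB Bs; have PA : (S `&` A) \in P by apply/mem_set; exists A, B.
    have [_ /= AE _] := FP (SigSub PA).
    have inA z : S z -> A z <-> F (SigSub PA) true z.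
      move=> Sz; have : (S `&` A) z <-> (S `&` F (SigSub PA) true) z by rewrite -AE.
      by move=> [AF FA]; split=> Az; [have [] := AF (conj Sz Az)|have [] := FA (conj Sz Az)].
    by rewrite (inA x Sx) (inA y Sy).
  have [Hs|Ks] := SHK s Ss.
    have [_ yx] := side K H (support_wall_sym HK) Hs.
    exact: (disj x Hx (yx Ky)).
  have [xy' _] := side H K HK Ks.
  exact: (disj y (xy' Hx) Ky).
- by move=> i [|]; have [[_ _ _ _ [[x [Sx Fx]] [y [Sy Fy]]]] _ _] := FP i;
    [exists x|exists y].
- move=> i j b c ij; have [Wi Ei si] := FP i; have [Wj Ej sj] := FP j.
  have neq : S `&` F i true <> S `&` F j true.
    by rewrite -Ei -Ej => /val_inj /eqP; rewrite (negbTE ij).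
  have [? ? ? ?] := support_wall_cross Wi Wj Ss si sj neq.
  have [_ [ci ci'] _ _ _] := Wi; have [_ [cj cj'] _ _ _] := Wj.
  by case: b c => -[]; exact: meets.
Qed.

End BalancedSupport.

Theorem proposition1p1 (R : realType) (M : ptopologicalType)
    (m : M -> M -> M -> M) (Mm : sclocc m)
    (mu : probability (borel M) R) (mu_balanced : balanced m mu) :
  is_cube m (measure_support mu).
Proof. exact: is_cube_support. Qed.
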